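(* Let $(x_t)$ be a real-valued stationary time series admitting a weak innovations representation: causal maps $G,H$ with $\nu_t=G(x_t,x_{t-1},\dots)$, $\hat x_t=H(\nu_t,\nu_{t-1},\dots)$, $(\nu_t)$ i.i.d. $\mathcal U[0,1]$, and $(\hat x_t)\stackrel{d}{=}(x_t)$ (equality of all finite-dimensional joint distributions). Assume the decoder $H$ is injective. Define the conditional distribution functions $$F(x\mid a_{t-1},a_{t-2},\dots)=\mathbb{P}[x_t\le x\mid x_{t-1}=a_{t-1},x_{t-2}=a_{t-2},\dots],$$ $$\hat F(x\mid b_{t-1},b_{t-2},\dots)=\mathbb{P}[\hat x_t\le x\mid \nu_{t-1}=b_{t-1},\nu_{t-2}=b_{t-2},\dots].$$ Then $F(x\mid a_{t-1},a_{t-2},\dots)=\hat F(x\mid b_{t-1},b_{t-2},\dots)$, as functions of $x$, almost everywhere, for almost all $a_{t-1},a_{t-2},\dots$, where $b_s=H^{-1}(a_s,a_{s-1},\dots)$, i.e. $(b_s)$ is the (unique, by injectivity of $H$) sequence with $a_s=H(b_s,b_{s-1},\dots)$ for all $s\le t-1$.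
   Context: The weak innovations representation relaxes the Wiener–Kallianpur innovations representation by requiring only that the decoder output $(\hat x_t)$ have the same distribution as $(x_t)$, rather than equal $(x_t)$. *)

(* Defs.v *)
From HB Require Import structures.
From mathcomp Require Import all_boot all_order all_algebra.
From mathcomp Require Import all_classical all_reals all_analysis.
Set Implicit Arguments. Unset Strict Implicit. Unset Printing Implicit Defensive.
Import Order.TTheory GRing.Theory Num.Theory.
Import numFieldNormedType.Exports.
Local Open Scope classical_set_scope.
Local Open Scope ring_scope.

(* A sequence a : nat -> R encodes the past (a_s, a_{s-1}, a_{s-2}, ...)  *)
(* via a k = a_{s-k}.                                                     *)
Definition seq_cyl (R : realType) : set (set (nat -> R)) :=
  fun A => exists (k : nat) (B : set R), measurable B /\
             A = (fun a : nat -> R => a k) @^-1` B.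

Arguments seq_cyl : clear implicits.
Definition seqR (R : realType) := g_sigma_algebraType (seq_cyl R).

Definition pastR (R : realType) (Omega : Type) (X : int -> Omega -> R)
  (s : int) (w : Omega) : seqR R := fun k : nat => X (s - k%:Z) w.

Definition Hseq (R : realType) (H : seqR R -> R) (b : seqR R) : seqR R :=
  fun k : nat => H (fun j : nat => b (k + j)%N).

Definition in01 (R : realType) (b : seqR R) : Prop := forall k, 0 <= b k <= 1.

Definition decoder_injective (R : realType) (H : seqR R -> R) : Prop :=
  forall b b' : seqR R, in01 b -> in01 b' -> Hseq H b = Hseq H b' -> b = b'.

Definition fdvec (R : realType) (Omega : Type) (X : int -> Omega -> R)
  (n : nat) (ts : n.-tuple int) (w : Omega) : n.-tuple R :=
  map_tuple (fun s => X s w) ts.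

Section Procs.
Context (R : realType) (d : measure_display) (Omega : measurableType d)
        (P : probability Omega R).

Definition stationary (X : int -> Omega -> R) : Prop :=
  forall (n : nat) (ts : n.-tuple int) (h : int) (B : set (n.-tuple R)),
    measurable B ->
    P (fdvec X ts @^-1` B) = P (fdvec X (map_tuple (fun s => s + h) ts) @^-1` B).

Definition same_fdd (X Y : int -> Omega -> R) : Prop :=
  forall (n : nat) (ts : n.-tuple int) (B : set (n.-tuple R)),
    measurable B -> P (fdvec X ts @^-1` B) = P (fdvec Y ts @^-1` B).

Definition iid_uniform01 (nu : int -> Omega -> R) : Prop :=
  (forall (s : int) (B : set R), measurable B ->
     P (nu s @^-1` B) = (@lebesgue_measure R) (B `&` `[0, 1])) /\
  (forall (n : nat) (ts : n.-tuple int) (B : 'I_n -> set R),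
     uniq ts -> (forall i, measurable (B i)) ->
     P (\bigcap_(i in [set: 'I_n]) (nu (tnth ts i) @^-1` B i)) =
     (\prod_(i < n) P (nu (tnth ts i) @^-1` B i))%E).

Definition is_distribution_function (f : R -> R) : Prop :=
  [/\ {homo f : u v / u <= v},
      (forall c : R, f x @[x --> c^'+] --> f c),
      f x @[x --> -oo] --> (0 : R)
    & f x @[x --> +oo] --> (1 : R)].

(* F is (a regular version of) the conditional distribution function
   F(c | z) = P[Y <= c | Z = z] of Y given Z, Z with values in R^N *)
Definition cond_distribution_function (Y : Omega -> R) (Z : Omega -> seqR R)
  (F : R -> seqR R -> R) : Prop :=
  [/\ (forall c : R, measurable_fun [set: seqR R] (F c)),
      (forall (c : R) (B : set (seqR R)), measurable B ->
         P ([set w | Y w <= c] `&` Z @^-1` B) =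
         (\int[P]_(w in Z @^-1` B) (F c (Z w))%:E)%E)
    & forall z : seqR R, is_distribution_function (fun c => F c z)].

End Procs.

(* Main.v *)
Require Import Defs.
From HB Require Import structures.
From mathcomp Require Import all_boot all_order all_algebra.
From mathcomp Require Import all_classical all_reals all_analysis.
From mathcomp Require Import measurable_realfun borel_hierarchy.
Import Order.TTheory GRing.Theory Num.Theory.
Import numFieldNormedType.Exports.
Local Open Scope classical_set_scope.
Local Open Scope ring_scope.

Set Implicit Arguments.
Unset Strict Implicit.
Unset Printing Implicit Defensive.

(** Let Z, N and Zh be the pasts of x, nu and xhat before time t, so that
    Zh = Hseq H N. Since (xhat_t, Zh) and (x_t, Z) have the same law, F is also
    a conditional distribution function of xhat_t given Zh. Injectivity of H
    makes N a function of Zh, but the measurability of this inverse, and of the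
    image of H, is not free. Rather than invoking the Lusin-Souslin theorem, use
    that finite measures on R^N are inner regular for compact sets: by Lusin's
    theorem, a measurable set D is filled up to a null set by countably many
    compact sets on each of which a given measurable map h is continuous, and
    their images make up a measurable E inside h @` D with h b in E for almost
    every b in D. For h injective, every event {N in D} thus agrees with an
    event {h N in E} up to a null set, so that conditioning on N and on
    Zh = Hseq H N is the same: F c (Hseq H b) is a conditional distribution
    function of xhat_t given N = b, hence agrees with Fhat c b for almost all b.
    By the same construction, this set of b's of full measure is mapped by
    Hseq H onto a set of full measure of pasts of x. *)

Lemma le_measure_subU2 (R : realType) (d : measure_display)
    (T : measurableType d) (mu : {measure set T -> \bar R}) (X A B : set T) :
  measurable X -> measurable A -> measurable B -> X `<=` A `|` B ->
  (mu X <= mu A + mu B)%E.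
Proof.
move=> mX mA mB XAB; apply: le_trans (measureU2 _ mA mB).
by apply: le_measure; rewrite ?inE//; exact: measurableU.
Qed.

Section inner_approximation.
Context {R : realType} {d : measure_display} {T : measurableType d}.
Variable mu : {finite_measure set T -> \bar R}.
Implicit Types (A K : set T) (C : set (set T)) (e : R).
Local Open Scope ereal_scope.

Definition inner_approx C A : Prop := forall e, (0 < e)%R ->
  exists K, [/\ C K, K `<=` A & mu (A `\` K) <= e%:E].

Lemma inner_approx_refl C A : C A -> inner_approx C A.
Proof.
by move=> CA e e0; exists A; split => //; rewrite setDv measure0 lee_fin ltW.
Qed.

Lemma inner_approx_subclass C C' A :
  C `<=` C' -> inner_approx C A -> inner_approx C' A.
Proof.
by move=> CC' iA e /iA[K [CK KA AK]]; exists K; split => //; exact: CC'.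
Qed.

Lemma inner_approx_trans C C' A : measurable A -> C `<=` measurable ->
  C' `<=` measurable -> (forall K, C' K -> inner_approx C K) ->
  inner_approx C' A -> inner_approx C A.
Proof.
move=> mA Cm C'm C'C iA e e0; have e20 : (0 < e / 2)%R by rewrite divr_gt0.
have [K [C'K KA AK]] := iA _ e20; have [L [CL LK KL]] := C'C _ C'K _ e20.
have mAK : measurable (A `\` K) by apply: measurableD => //; exact: C'm.
have mKL : measurable (K `\` L) by apply: measurableD; [exact: C'm|exact: Cm].
exists L; split => //; first exact: subset_trans KA.
rewrite [e]splitr EFinD; apply: le_trans (leeD AK KL).
apply: le_measure_subU2 => //; first by apply: measurableD => //; exact: Cm.
by move=> x [Ax nLx]; have [Kx|nKx] := pselect (K x); [right|left].
Qed.

Lemma inner_approx_setT_sub C A : measurable A -> C `<=` measurable ->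
  (forall K, C K -> C (A `&` K)) -> inner_approx C setT -> inner_approx C A.
Proof.
move=> mA Cm CA iT e /iT[K [CK _ TK]]; exists (A `&` K).
split; [exact: CA|exact: subIsetl|apply: le_trans TK].
apply: le_measure; rewrite ?inE.
- by apply: measurableD => //; exact/Cm/CA.
- by apply: measurableD => //; exact: Cm.
- by move=> x [Ax nAKx]; split => // Kx; exact: nAKx.
Qed.

Lemma inner_approx_nondecreasing C (F : (set T)^nat) :
  (forall n, measurable (F n)) -> (forall n, C (F n)) -> nondecreasing_seq F ->
  inner_approx C (\bigcup_n F n).
Proof.
move=> mF CF ndF e e0; pose D n := \bigcup_k F k `\` F n.
have mD n : measurable (D n).
  by apply: measurableD => //; exact: bigcupT_measurable.
have D0 : \bigcap_n D n = set0.
  apply/seteqP; split => // x Dx.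
  by have [[k _ Fkx] _] := Dx 0%N I; have [] := Dx k I.
have : mu \o D @ \oo --> 0.
  rewrite -(measure0 mu) -D0; apply: nonincreasing_cvg_mu => //.
  - by rewrite ltey_eq fin_num_measure.
  - exact: bigcapT_measurable.
  - by move=> m n mn; apply/subsetPset; apply: setDS; exact/subsetPset/ndF.
move/fine_cvgP => [_ /cvgrPdist_le /(_ e e0)[n _ /(_ n (leqnn n))]] /=.
rewrite sub0r normrN => Dn; exists (F n); split => //; first exact: bigcup_sup.
rewrite -/(D n) -[leLHS]fineK ?fin_num_measure// lee_fin.
exact: le_trans (ler_norm _) Dn.
Qed.

Lemma inner_approx_choice (C : nat -> set (set T)) (A : (set T)^nat) e :
  (0 < e)%R -> (forall k, measurable (A k)) ->
  (forall k, C k `<=` measurable) ->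
  (forall k, inner_approx (C k) (A k)) ->
  exists F : (set T)^nat, [/\ (forall k, C k (F k)), (forall k, F k `<=` A k) &
    mu (\bigcup_k (A k `\` F k)) <= e%:E].
Proof.
move=> e0 mA Cm iA.
have /choice[F FP] : forall k, exists K,
    [/\ C k K, K `<=` A k & mu (A k `\` K) <= (e / (2 ^ k.+1)%:R)%:E].
  by move=> k; apply: iA; rewrite divr_gt0// ltr0n expn_gt0.
have mAF k : measurable (A k `\` F k).
  by apply: measurableD => //; apply: (Cm k); case: (FP k).
exists F; split => [k|k|]; [by case: (FP k)|by case: (FP k)|].
apply: (@le_trans _ _ (\sum_(k <oo) mu (A k `\` F k))).
  by apply: measure_sigma_subadditive => //; exact: bigcupT_measurable.
apply: le_trans (epsilon_trick0 xpredT (ltW e0)).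
by apply: lee_nneseries => // k _; case: (FP k).
Qed.

Lemma inner_approx_bigcap (C : nat -> set (set T)) (A : (set T)^nat) :
  (forall k, measurable (A k)) -> (forall k, C k `<=` measurable) ->
  (forall k, inner_approx (C k) (A k)) ->
  inner_approx [set \bigcap_k F k | F in [set F | forall k, C k (F k)]]
    (\bigcap_k A k).
Proof.
move=> mA Cm iA e e0; have [F [CF FA AF]] := inner_approx_choice e0 mA Cm iA.
have mF k : measurable (F k) by exact/Cm/CF.
exists (\bigcap_k F k); split; [by exists F|exact: subset_bigcap|].
apply: le_trans AF; apply: le_measure; rewrite ?inE.
- by apply: measurableD; exact: bigcapT_measurable.
- by apply: bigcupT_measurable => k; exact: measurableD.
- move=> x [Ax] /existsNP[k /not_implyP[_ nFx]].
  by exists k => //; split => //; exact: Ax.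
Qed.

Lemma inner_approx_bigcup C (A : (set T)^nat) :
  (forall k, measurable (A k)) ->
  C `<=` measurable -> C set0 -> setU_closed C ->
  (forall k, inner_approx C (A k)) -> inner_approx C (\bigcup_k A k).
Proof.
move=> mA Cm C0 CU iA.
pose C' := [set \bigcup_k F k | F in [set F : (set T)^nat | forall k, C (F k)]].
have C'm : C' `<=` measurable.
  by move=> _ [F CF <-]; apply: bigcupT_measurable => k; exact/Cm/CF.
apply: (inner_approx_trans _ Cm C'm) => [|_ [F CF <-]|e e0].
- exact: bigcupT_measurable.
- rewrite -bigcup_bigsetU_bigcup.
  have CF_ n : C (\big[setU/set0]_(i < n.+1) F i) by apply: big_ind.
  apply: inner_approx_nondecreasing => // [n|m n mn]; first exact/Cm/CF_.
  by apply/subsetPset; exact: subset_bigsetU.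
- have [F [CF FA AF]] := inner_approx_choice e0 mA (fun=> Cm) iA.
  have mF k : measurable (F k) by exact/Cm/CF.
  exists (\bigcup_k F k); split; [by exists F|exact: subset_bigcup|].
  apply: le_trans AF; apply: le_measure; rewrite ?inE.
  + by apply: measurableD; exact: bigcupT_measurable.
  + by apply: bigcupT_measurable => k; exact: measurableD.
  + move=> x [[k _ Akx] nFx]; exists k => //; split => // Fkx.
    by apply: nFx; exists k.
Qed.

Lemma inner_approx_sigma_algebra C : C `<=` measurable -> C set0 ->
  setU_closed C ->
  (forall F : (set T)^nat, (forall n, C (F n)) -> C (\bigcap_n F n)) ->
  inner_approx C setT ->
  sigma_algebra setT
    [set A | [/\ measurable A, inner_approx C A & inner_approx C (~` A)]].
Proof.
move=> Cm C0 CU CI iT; split=> [|A [mA iA iAc]|A rA].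
- by split; [exact: measurable0|exact: inner_approx_refl|rewrite setC0].
- by rewrite setTD; split; [exact: measurableC| |rewrite setCK].
have mA k : measurable (A k) by case: (rA k).
split; first exact: bigcupT_measurable.
- by apply: inner_approx_bigcup => // k; case: (rA k).
- rewrite setC_bigcup; apply: (inner_approx_subclass (C :=
    [set \bigcap_k F k | F in [set F : (set T)^nat | forall k, C (F k)]])).
    by move=> _ [F CF <-]; exact: CI.
  apply: (inner_approx_bigcap (C := fun=> C)) => // k; last by case: (rA k).
  exact: measurableC.
Qed.

Lemma inner_approx_exhaust C A : measurable A -> C `<=` measurable ->
  inner_approx C A -> exists F : (set T)^nat, [/\ (forall n, C (F n)),
    (forall n, F n `<=` A) & {ae mu, forall x, A x -> (\bigcup_n F n) x}].
Proof.
move=> mA Cm iA.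
have /choice[F FP] : forall n, exists K,
    [/\ C K, K `<=` A & mu (A `\` K) <= (n.+1%:R^-1)%:E].
  by move=> n; apply: iA; rewrite invr_gt0.
have CF n : C (F n) by case: (FP n).
exists F; split => // [n|]; first by case: (FP n).
have mAF : measurable (A `\` \bigcup_n F n).
  by apply: measurableD => //; apply: bigcupT_measurable => n; exact/Cm/CF.
exists (A `\` \bigcup_n F n); split => // [|x /not_implyP//].
apply/eqP; rewrite -measure_le0.
apply/lee_addgt0Pr => e e0; rewrite add0e; pose n := Num.truncn e^-1.
apply: (@le_trans _ _ (n.+1%:R^-1)%:E); last first.
  by rewrite lee_fin invf_ple ?posrE// ltW// truncnS_gt.
case: (FP n) => _ _; apply: le_trans; apply: le_measure; rewrite ?inE//.
- by apply: measurableD => //; exact/Cm/CF.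
- by apply: setDS; exact: bigcup_sup.
Qed.

End inner_approximation.

Lemma second_countable_seq (T : topologicalType) : @second_countable T ->
  exists B : (set T)^nat, (forall n, open (B n)) /\
    forall x V, nbhs x V -> exists2 n, B n x & B n `<=` V.
Proof.
move=> [S /pfcard_geP[->|[f]] [So Sbase]].
  exists (fun=> set0); split => [n|x V]; first exact: open0.
  by case/Sbase => U [].
exists f; split => [n|x V /Sbase[U [SU Ux] UV]]; first exact/So/funS.
by have [n _ fnU] := @surj _ _ _ _ f U SU; exists n; rewrite fnU.
Qed.

Lemma open_Fsigma (T : topologicalType) (U : set T) :
  @second_countable T -> regular_space T -> open U -> Fsigma U.
Proof.
move=> /second_countable_seq[B [_ Bbase]] regT oU.
exists (fun n => if `[< closure (B n) `<=` U >] then closure (B n) else set0).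
  by move=> n; case: asboolP => _; [exact: closed_closure|exact: closed0].
apply/seteqP; split => [x Ux|x [n _]]; last by case: asboolP => // BU /BU.
have [V Vx VU] := regT x U (open_nbhs_nbhs (conj oU Ux)).
have [n Bnx BnV] := Bbase x V Vx; exists n => //.
rewrite asboolT; first exact: subset_closure.
by apply: subset_trans VU; exact: closure_subset.
Qed.

Definition generates_borel (T : ptopologicalType) (G : set (set T)) : Prop :=
  G.-sigma.-measurable = <<s @open T >>.

Section compact_inner_regularity.
Context {R : realType} {T : ptopologicalType} {G : set (set T)}.
Hypothesis G_borel : generates_borel G.
Hypothesis T_hausdorff : hausdorff_space T.
Local Notation Tm := (g_sigma_algebraType G).
Variable mu : {finite_measure set Tm -> \bar R}.

Definition compact_inner_regular : Prop :=
  forall A : set Tm, measurable A -> inner_approx mu (@compact T) A.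

Lemma open_borel : @open T `<=` G.-sigma.-measurable.
Proof. by move=> U oU; rewrite G_borel; exact: sub_sigma_algebra. Qed.

Lemma closed_borel : @closed T `<=` G.-sigma.-measurable.
Proof. by move=> A /closed_openC/open_borel/measurableC; rewrite setCK. Qed.

Lemma compact_borel : @compact T `<=` G.-sigma.-measurable.
Proof. by move=> K /(compact_closed T_hausdorff)/closed_borel. Qed.

Lemma compact_bigcap (F : (set T)^nat) :
  (forall n, compact (F n)) -> compact (\bigcap_n F n).
Proof.
move=> cF; apply: (subclosed_compact _ (cF 0%N)); last exact: bigcap_inf.
by apply: closed_bigI => n _; exact: compact_closed.
Qed.

Lemma tight_compact_inner_regular : (forall U : set T, open U -> Fsigma U) ->
  inner_approx mu (@compact T) setT -> compact_inner_regular.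
Proof.
move=> openF tight_mu A; rewrite [X in X A -> _]G_borel.
have iclosed (B : set T) : closed B -> inner_approx mu (@compact T) B.
  move=> cB; apply: inner_approx_setT_sub tight_mu; first exact: closed_borel.
    exact: compact_borel.
  by move=> K cK; rewrite setIC; exact: compact_closedI.
suff : <<s @open T >> `<=` [set A : set Tm | [/\ measurable A,
    inner_approx mu (@compact T) A & inner_approx mu (@compact T) (~` A)]].
  by move=> /[apply] -[].
apply: smallest_sub.
  apply: inner_approx_sigma_algebra tight_mu.
  - exact: compact_borel.
  - exact: compact0.
  - exact: compactU.
  - exact: compact_bigcap.
move=> U oU; split; [exact: open_borel| |exact/iclosed/open_closedC].
have [F cF ->] := openF U oU; apply: inner_approx_bigcup.
- by move=> n; exact: closed_borel.
- exact: compact_borel.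
- exact: compact0.
- exact: compactU.
- by move=> n; exact: iclosed.
Qed.

Hypothesis mu_regular : compact_inner_regular.

Lemma compact_split_approx (A D : set Tm) : measurable A -> measurable D ->
  inner_approx mu [set K : set T | compact K /\ compact (K `\` A)] D.
Proof.
move=> mA mD e e0; have e20 : 0 < e / 2 by rewrite divr_gt0.
have mDA : measurable (D `&` A) by exact: measurableI.
have mDnA : measurable (D `\` A) by exact: measurableD.
have [K [cK KDA DAK]] := mu_regular mDA e20.
have [L [cL LDA DAL]] := mu_regular mDnA e20.
have mK := compact_borel cK; have mL := compact_borel cL.
have KL_A : (K `|` L) `\` A = L.
  apply/seteqP; split => [x [[/KDA[]|]//]|x Lx]; split; first by right.
  by case: (LDA _ Lx).
exists (K `|` L); split; first by split; [exact: compactU|rewrite KL_A].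
  by move=> x [/KDA[]|/LDA[]].
have mDAK : measurable (D `&` A `\` K) by exact: measurableD.
have mDAL : measurable (D `\` A `\` L) by exact: measurableD.
rewrite [e]splitr EFinD; apply: le_trans (leeD DAK DAL).
apply: le_measure_subU2 => //.
  by apply: measurableD => //; exact: measurableU.
move=> x [Dx /not_orP[nKx nLx]].
by have [Ax|nAx] := pselect (A x); [left|right].
Qed.

Lemma lusin (Y : topologicalType) (h : T -> Y) (D : set Tm) :
  @second_countable Y -> measurable D ->
  (forall U, open U -> measurable (h @^-1` U : set Tm)) ->
  inner_approx mu [set K : set T | compact K /\ {within K, continuous h}] D.
Proof.
move=> /second_countable_seq[B [oB Bbase]] mD mh.
pose C n := [set K : set T | compact K /\ compact (K `\` h @^-1` B n)].
have Cm n : C n `<=` G.-sigma.-measurable.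
  by move=> K [cK _]; exact: compact_borel.
have iC n : inner_approx mu (C n) D.
  by apply: compact_split_approx => //; exact: mh _ (oB n).
have := inner_approx_bigcap (fun=> mD) Cm iC.
rewrite bigcap_const; last by exists 0%N.
apply: inner_approx_subclass => _ [F CF <-].
split; first by apply: compact_bigcap => n; case: (CF n).
(* The preimage of each basic open set is relatively open in [\bigcap_n F n],
   its complement being cut out by the compact set [F n `\` h @^-1` B n]. *)
apply/subspace_continuousP => x Fx V /Bbase[n Bnhx BnV].
have : nbhs x (~` (F n `\` h @^-1` B n)).
  apply: open_nbhs_nbhs; split; last by move=> [].
  by apply: closed_openC; apply: compact_closed => //; case: (CF n).
apply: filterS => y nFB /(_ n I) Fny; apply: BnV.
by apply: contrapT => nBy; exact: nFB.
Qed.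

End compact_inner_regularity.

Lemma ae_measurable_subset (R : realType) (d : measure_display)
    (T : measurableType d) (mu : {measure set T -> \bar R}) (Q : set T) :
  {ae mu, forall x, Q x} ->
  exists D, [/\ measurable D, D `<=` Q & {ae mu, forall x, D x}].
Proof.
move=> [N [mN N0 QN]]; exists (~` N); split; first exact: measurableC.
- by move=> x nNx; apply: contrapT => /QN.
- by exists N; split => // x /contrapT.
Qed.

Definition ae_generates_sigma_algebra {R : realType} {d d' : measure_display}
    {X : measurableType d} {Y : measurableType d'} (mu : set X -> \bar R)
    (h : X -> Y) : Prop :=
  forall B, measurable B ->
    exists2 E, measurable E & {ae mu, forall x, B x <-> E (h x)}.

Section measurable_images.
Context {R : realType} {X Y : ptopologicalType}
  {GX : set (set X)} {GY : set (set Y)}.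
Hypotheses (X_borel : generates_borel GX) (Y_borel : generates_borel GY).
Hypotheses (X_hausdorff : hausdorff_space X) (Y_hausdorff : hausdorff_space Y).
Hypothesis Y_second_countable : @second_countable Y.
Local Notation Xm := (g_sigma_algebraType GX).
Local Notation Ym := (g_sigma_algebraType GY).
Variables (mu : {finite_measure set Xm -> \bar R}) (h : {mfun Xm >-> Ym}).
Hypothesis mu_regular : compact_inner_regular mu.

Lemma ae_measurable_image (D : set Xm) : measurable D ->
  exists E : set Ym, [/\ measurable E, E `<=` h @` D &
    {ae mu, forall x, D x -> E (h x)}].
Proof.
move=> mD.
have mpre U : open U -> measurable (h @^-1` U).
  by move=> /(open_borel Y_borel) mU; exact: measurable_funPTI.
have iD := lusin X_borel X_hausdorff mu_regular Y_second_countable mD mpre.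
have Cm : [set K : set X | compact K /\ {within K, continuous h}] `<=`
    GX.-sigma.-measurable.
  by move=> K [cK _]; exact: (compact_borel X_borel).
have [F [cF FD DF]] := inner_approx_exhaust mD Cm iD.
exists (\bigcup_n h @` F n); split.
- apply: bigcupT_measurable => n; have [cFn hFn] := cF n.
  by apply: (compact_borel Y_borel Y_hausdorff); exact: continuous_compact.
- by apply: bigcup_sub => n _; exact: image_subset.
- by apply: filterS DF => x + Dx => /(_ Dx)[n _ Fx]; exists n => //; exists x.
Qed.

Lemma ae_pushforward_image (Q : Xm -> Prop) : {ae mu, forall x, Q x} ->
  {ae pushforward mu h, forall y, exists2 x, Q x & h x = y}.
Proof.
move=> /ae_measurable_subset[D [mD DQ aeD]].
have [E [mE ED DE]] := ae_measurable_image mD.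
exists (~` E); split; first exact: measurableC.
- rewrite /pushforward; apply: measure_negligible.
    exact/measurable_funPTI/measurableC.
  by apply: filterS2 aeD DE => x Dx; exact.
- by move=> y; apply: contra_not => /ED[x Dx <-]; exists x => //; exact: DQ.
Qed.

Lemma injective_ae_generates_sigma_algebra (Q : set Xm) :
  {ae mu, forall x, Q x} -> set_inj Q h -> ae_generates_sigma_algebra mu h.
Proof.
move=> /ae_measurable_subset[D [mD DQ aeD]] injh B mB.
have [E [mE EBD BDE]] := ae_measurable_image (measurableI _ _ mB mD).
exists E => //; apply: filterS2 aeD BDE => x Dx BDEx.
split => [Bx|/EBD[y [By Dy] hyx]]; first exact: BDEx.
by rewrite -(injh y x) ?inE//; exact: DQ.
Qed.

End measurable_images.

HB.instance Definition _ (I : Type) (T : I -> ptopologicalType) :=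
  Pointed.on (prod_topology T).

Lemma continuous_preimage_borel (R : realType) (T : ptopologicalType)
    (f : T -> R) (B : set R) :
  continuous f -> measurable B -> <<s @open T >> (f @^-1` B).
Proof.
move=> cf; suff mf : measurable_fun [set: g_sigma_algebraType (@open T)] f.
  by move=> /(mf measurableT); rewrite setTI.
apply: (@measurability _ _ _ R _ _ (@RGenOpens.G R)).
  exact: RGenOpens.measurableE.
move=> _ [_ [x [y ->]] <-]; rewrite setTI; apply: sub_sigma_algebra.
by apply: open_comp; [move=> a _; exact: cf|exact: itv_open].
Qed.

(* [seqR R] and [{ptws nat -> R}] are the same type [nat -> R]: the former
   carries the sigma-algebra, the latter the topology. *)
Section sequence_space.
Context {R : realType}.
Implicit Type s : seq (nat * (rat * rat)).

Lemma measurable_coordinate_preimage (k : nat) (B : set R) :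
  measurable B -> measurable ((fun a : seqR R => a k) @^-1` B).
Proof. by move=> mB; apply: sub_sigma_algebra; exists k, B. Qed.

Lemma measurable_coordinate (k : nat) :
  measurable_fun [set: seqR R] (fun a : seqR R => a k).
Proof.
by move=> _ B mB; rewrite setTI; exact: measurable_coordinate_preimage.
Qed.

Lemma measurable_fun_seqR (d : measure_display) (T : measurableType d)
    (f : T -> seqR R) :
  (forall k, measurable_fun [set: T] (fun x => f x k)) ->
  measurable_fun [set: T] f.
Proof.
move=> mf; apply: (@measurability _ _ T (seqR R) _ f (seq_cyl R)) => //.
by move=> _ [_ [k [B [mB ->]]] <-]; exact: (mf k measurableT B mB).
Qed.

Lemma measurable_reindex (f : nat -> nat) :
  measurable_fun [set: seqR R] (fun a : seqR R => a \o f : seqR R).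
Proof. by apply: measurable_fun_seqR => k; exact: measurable_coordinate. Qed.

Lemma ptws_hausdorff : hausdorff_space {ptws nat -> R}.
Proof. exact: (@hausdorff_product nat (fun=> R) (fun=> @Rhausdorff R)). Qed.

Definition rat_box s : set {ptws nat -> R} :=
  [set a | all (fun i => ratr i.2.1 < a i.1 < ratr i.2.2) s].

Lemma rat_box_nil : rat_box [::] = setT.
Proof. by apply/seteqP; split. Qed.

Lemma rat_box_cons k p q s : rat_box ((k, (p, q)) :: s) =
  (fun a : {ptws nat -> R} => a k) @^-1` `]ratr p, ratr q[ `&` rat_box s.
Proof. by apply/seteqP; split=> a; rewrite /rat_box /= in_itv/= => /andP. Qed.

Lemma rat_box_open s : open (rat_box s).
Proof.
elim: s => [|[k [p q]] s ih]; first by rewrite rat_box_nil; exact: openT.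
rewrite rat_box_cons; apply: openI => //.
apply: open_comp; last exact: itv_open.
by move=> a _; exact: (@proj_continuous nat (fun=> R)).
Qed.

Lemma measurable_rat_box s : measurable (rat_box s : set (seqR R)).
Proof.
elim: s => [|[k [p q]] s ih]; first by rewrite rat_box_nil.
rewrite rat_box_cons; apply: measurableI => //.
exact: measurable_coordinate_preimage.
Qed.

Lemma rat_box_basis : basis (range rat_box).
Proof.
split=> [_ [s _ <-]|a U]; first exact: rat_box_open.
pose F := filter_from [set s | rat_box s a] rat_box.
have FF : Filter F.
  apply: filter_from_filter; first by exists [::].
  move=> s1 s2 s1a s2a; exists (s1 ++ s2).
    by rewrite /rat_box/= all_cat; apply/andP; split.
  by move=> b; rewrite /rat_box/= all_cat => /andP.
suff Fa : {ptws, F --> a} by move=> /Fa[s sa sU]; exists (rat_box s).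
apply/pointwise_cvgP => k V /nbhs_ballP[e/= e0 eV].
have [p /[!in_itv]/= /andP[p1 p2]] : exists p, ratr p \in `](a k - e), (a k)[.
  by apply: rat_in_itvoo; rewrite ltrBlDr ltrDl.
have [q /[!in_itv]/= /andP[q1 q2]] : exists q, ratr q \in `](a k), (a k + e)[.
  by apply: rat_in_itvoo; rewrite ltrDl.
exists [:: (k, (p, q))]; first by rewrite /rat_box/= p2 q1.
move=> b; rewrite /rat_box/= andbT => /andP[pb bq].
by apply: eV; rewrite /ball/= ltr_distlC (lt_trans p1)//= (lt_trans bq).
Qed.

Lemma ptws_second_countable : @second_countable {ptws nat -> R}.
Proof.
exists (range rat_box); last exact: rat_box_basis.
exact: card_le_trans (card_image_le _ _) (countableP _).
Qed.

Lemma seq_cyl_borel : generates_borel (seq_cyl R : set (set {ptws nat -> R})).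
Proof.
apply/seteqP; split; apply: smallest_sub; try exact: smallest_sigma_algebra.
- move=> _ [k [B [mB ->]]].
  apply: (continuous_preimage_borel (T := {ptws nat -> R})) mB.
  exact: (@proj_continuous nat (fun=> R)).
- move=> U oU.
  have -> : U = \bigcup_s (if `[< rat_box s `<=` U >] then rat_box s else set0).
    apply/seteqP; split => [a Ua|a [s _]]; last by case: asboolP => // sU /sU.
    have nbhsU : nbhs a U by exact: open_nbhs_nbhs.
    have [_ [[s _ <-] sa] sU] := rat_box_basis.2 a U nbhsU.
    by exists s => //; rewrite asboolT.
  apply: countable_bigcupT_measurable => [|s]; first exact: countableP.
  by case: asboolP => // _; exact: measurable_rat_box.
Qed.

Variable mu : {finite_measure set (seqR R) -> \bar R}.

Lemma seqR_tight : inner_approx mu (@compact {ptws nat -> R}) setT.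
Proof.
pose cube (k n : nat) : set (seqR R) :=
  (fun a => a k) @^-1` `[- n%:R, n%:R]%classic.
have mcube k n : measurable (cube k n) by exact: measurable_coordinate_preimage.
have icube k : inner_approx mu (range (cube k)) setT.
  have <- : \bigcup_n cube k n = setT.
    apply/seteqP; split => // a _; exists (Num.truncn `|a k|).+1 => //.
    by rewrite /cube /= in_itv/= -ler_norml ltW// truncnS_gt.
  apply: inner_approx_nondecreasing => // m n mn.
  apply/subsetPset => a; rewrite /cube /= !in_itv/= -!ler_norml.
  by move=> /le_trans; apply; rewrite ler_nat.
have mrange k : range (cube k) `<=` measurable by move=> _ [n _ <-].
have := inner_approx_bigcap (fun=> measurableT) mrange icube.
rewrite bigcapT// => /inner_approx_subclass; apply => _ [F Fcube <-].
have /choice[N FN] : forall k, exists n, cube k n = F k.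
  by move=> k; have [n _ cubeF] := Fcube k; exists n.
rewrite (_ : \bigcap_k F k =
    [set a | forall k, `[- (N k)%:R, (N k)%:R]%classic (a k)]); last first.
  by apply/seteqP; split => a Fa k => [|_]; have := Fa k; rewrite -FN; exact.
exact: (@tychonoff nat (fun=> R) _ (fun k => @segment_compact R _ _)).
Qed.

Lemma seqR_compact_inner_regular :
  compact_inner_regular (T := {ptws nat -> R}) mu.
Proof.
apply: tight_compact_inner_regular.
- exact: seq_cyl_borel.
- exact: ptws_hausdorff.
- move=> U; apply: open_Fsigma; last exact: uniform_regular.
  exact: ptws_second_countable.
- exact: seqR_tight.
Qed.

Variable h : {mfun seqR R >-> seqR R}.

Lemma ae_pushforward_image_seqR (Q : seqR R -> Prop) :
  {ae mu, forall a, Q a} ->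
  {ae pushforward mu h, forall b, exists2 a, Q a & h a = b}.
Proof.
apply: (ae_pushforward_image (X := {ptws nat -> R}) (Y := {ptws nat -> R}));
  by [exact: seq_cyl_borel|exact: ptws_hausdorff|exact: ptws_second_countable|
      exact: seqR_compact_inner_regular].
Qed.

Lemma injective_ae_generates_seqR (Q : set (seqR R)) :
  {ae mu, forall a, Q a} -> set_inj Q h -> ae_generates_sigma_algebra mu h.
Proof.
apply: (injective_ae_generates_sigma_algebra (X := {ptws nat -> R})
  (Y := {ptws nat -> R}));
  by [exact: seq_cyl_borel|exact: ptws_hausdorff|exact: ptws_second_countable|
      exact: seqR_compact_inner_regular].
Qed.

End sequence_space.

Section finite_dimensional_laws.
Context {R : realType} {d : measure_display} {Omega : measurableType d}
  {P : probability Omega R}.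
Implicit Types X Y : int -> {RV P >-> R}.

Lemma measurable_pastR X (s : int) :
  measurable_fun [set: Omega] (pastR (fun s => X s) s).
Proof. by apply: measurable_fun_seqR => k; exact: measurable_funP. Qed.

HB.instance Definition _ X (s : int) := isMeasurableFun.Build _ _ _ _
  (pastR (fun s => X s) s) (measurable_pastR X s).

Definition finite_box : set (set (seqR R)) :=
  [set A | exists (n : nat) (B : nat -> set R), [/\ forall i, measurable (B i),
    forall i, (n <= i)%N -> B i = setT & A = [set a | forall i, B i (a i)]]].

Lemma measurable_finite_box (A : set (seqR R)) : finite_box A -> measurable A.
Proof.
move=> [_ [B [mB _ ->]]].
rewrite (_ : [set a | _] = \bigcap_i ((fun a : seqR R => a i) @^-1` B i)).
  by apply: bigcapT_measurable => i; exact: measurable_coordinate_preimage.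
by apply/seteqP; split=> [a Ba i _|a Ba i]; exact: Ba.
Qed.

Lemma finite_box_generates : @measurable _ (seqR R) = <<s finite_box >>.
Proof.
apply/seteqP; split; apply: smallest_sub; try exact: smallest_sigma_algebra.
- move=> _ [k [B [mB ->]]]; apply: sub_sigma_algebra.
  exists k.+1, (fun i => if i == k then B else setT); split => [i|i|].
  + by case: ifP.
  + by case: eqP => // ->; rewrite ltnn.
  + apply/seteqP; split => [a /= Ba i|a /= /(_ k)]; last by rewrite eqxx.
    by case: eqP => // ->.
- exact: measurable_finite_box.
Qed.

Lemma finite_box_setI_closed : setI_closed finite_box.
Proof.
move=> _ _ [n [B [mB BT ->]]] [m [C [mC CT ->]]].
exists (maxn n m), (fun i => B i `&` C i); split => [i|i|].
- exact: measurableI.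
- by rewrite geq_max => /andP[ni mi]; rewrite BT// CT// setTI.
- apply/seteqP; split => [a [Ba Ca] i|a BCa]; first by split.
  by split => i; case: (BCa i).
Qed.

Lemma same_fdd_pastR X Y (s : int) (A : set (seqR R)) :
  same_fdd P (fun s => X s) (fun s => Y s) -> measurable A ->
  P (pastR (fun s => X s) s @^-1` A) = P (pastR (fun s => Y s) s @^-1` A).
Proof.
move=> XY; apply: (measure_unique finite_box (fun=> setT) finite_box_generates
  finite_box_setI_closed _ _ (distribution P (pastR (fun s => X s) s))
  (distribution P (pastR (fun s => Y s) s))).
- by move=> _; exists 0%N, (fun=> setT); split => //; apply/seteqP; split.
- by rewrite bigcup_const.
- move=> _ [n [B [mB BT ->]]].
  pose ts := [tuple s - (i : nat)%:Z | i < n].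
  pose Bn : set (n.-tuple R) :=
    \bigcap_(i in [set: 'I_n]) ((fun u => tnth u i) @^-1` B i).
  have mBn : measurable Bn.
    apply: fin_bigcap_measurable => [|i _]; first exact: finite_finset.
    by rewrite -[X in measurable X]setTI; exact: measurable_tnth.
  have pastE (Z : int -> Omega -> R) :
      pastR Z s @^-1` [set a | forall i, B i (a i)] = fdvec Z ts @^-1` Bn.
    apply/seteqP; split => w /= Bw.
      by move=> i _ /=; rewrite tnth_map tnth_mktuple; exact: Bw.
    move=> i; have [i_lt|/BT->//] := ltnP i n; have := Bw (Ordinal i_lt) I.
    by rewrite /= tnth_map tnth_mktuple.
  by have := XY n ts Bn mBn; rewrite -!pastE.
- by move=> _; rewrite ltey_eq fin_num_measure.
Qed.

End finite_dimensional_laws.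

Lemma right_continuous_eq_rat (R : realType) (f g : R -> R) :
  right_continuous f -> right_continuous g ->
  (forall q : rat, f (ratr q) = g (ratr q)) -> f =1 g.
Proof.
move=> fr gr fg c; apply/eqP; rewrite -subr_eq0.
apply: contrapT => /negP fgc.
have [r /= r0 rP] := cvgr_neq0 _ (cvgB (fr c) (gr c)) fgc.
have [q /[!in_itv]/= /andP[cq qr]] : exists q, ratr q \in `]c, (c + r)[.
  by apply: rat_in_itvoo; rewrite ltrDl.
suff : f (ratr q) - g (ratr q) != 0 by rewrite fg subrr eqxx.
by apply: rP => //; rewrite /ball/= ltr_distlC (lt_trans _ cq) ?ltrBlDr ?ltrDl.
Qed.

Lemma distribution_function_ge0 (R : realType) (f : R -> R) (c : R) :
  is_distribution_function f -> 0 <= f c.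
Proof.
move=> [fnd _ f0 _]; rewrite -(cvg_lim (@Rhausdorff R) f0); apply: limr_le.
  by apply/cvg_ex; exists 0.
near=> x; apply: fnd; near: x; apply: nbhs_ninfty_le; exact: num_real.
Unshelve. all: by end_near. Qed.

Lemma distribution_function_le1 (R : realType) (f : R -> R) (c : R) :
  is_distribution_function f -> f c <= 1.
Proof.
move=> [fnd _ _ f1]; rewrite -(cvg_lim (@Rhausdorff R) f1); apply: limr_ge.
  by apply/cvg_ex; exists 1.
near=> x; apply: fnd; near: x; apply: nbhs_pinfty_ge; exact: num_real.
Unshelve. all: by end_near. Qed.

Section almost_everywhere_equal_sets.
Context {R : realType} {d : measure_display} {T : measurableType d}.
Variable mu : {measure set T -> \bar R}.
Local Open Scope ereal_scope.

Lemma ge0_integral_ae_eq_set (A B : set T) (f : T -> \bar R) :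
  measurable A -> measurable B -> measurable_fun [set: T] f ->
  (forall x, 0 <= f x) -> {ae mu, forall x, A x <-> B x} ->
  \int[mu]_(x in A) f x = \int[mu]_(x in B) f x.
Proof.
move=> mA mB mf f0 AB; rewrite integral_mkcond [RHS]integral_mkcond.
have mrestrict D : measurable D -> measurable_fun [set: T] (f \_ D).
  by move=> mD; apply/(measurable_restrictT f mD); exact: measurable_funTS.
apply: ge0_ae_eq_integral => //; try exact: mrestrict.
- by move=> x _; exact: erestrict_ge0.
- by move=> x _; exact: erestrict_ge0.
- apply: filterS AB => x ABx _; rewrite !patchE.
  by rewrite (_ : (x \in A) = (x \in B))//; apply/idP/idP; rewrite !inE => /ABx.
Qed.

Lemma measure_ae_eq_set (A B : set T) : measurable A -> measurable B ->
  {ae mu, forall x, A x <-> B x} -> mu A = mu B.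
Proof.
move=> mA mB AB.
have := @ge0_integral_ae_eq_set A B (cst 1) mA mB (measurable_cst _) _ AB.
by rewrite !integral_cst// !mul1e; apply.
Qed.

End almost_everywhere_equal_sets.

Lemma ae_pushforward_preimage (R : realType) (d d' : measure_display)
    (T : measurableType d) (T' : measurableType d')
    (mu : {measure set T -> \bar R}) (f : {mfun T >-> T'}) (Q : T' -> Prop) :
  {ae pushforward mu f, forall y, Q y} -> {ae mu, forall x, Q (f x)}.
Proof.
move=> [N [mN N0 QN]]; exists (f @^-1` N).
by split => //; [exact: measurable_funPTI|move=> x; exact: QN].
Qed.

Section conditional_distribution_functions.
Context {R : realType} {d : measure_display} {Omega : measurableType d}
  {P : probability Omega R}.
Implicit Types (Y : {RV P >-> R}) (Z : {mfun Omega >-> seqR R}).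
Implicit Type F : R -> seqR R -> R.

Lemma integral_distribution_function_pushforward Z F (c : R)
    (B : set (seqR R)) :
  measurable B -> measurable_fun [set: seqR R] (F c) ->
  (forall z, is_distribution_function (F^~ z)) ->
  (\int[distribution P Z]_(z in B) (F c z)%:E =
   \int[P]_(w in Z @^-1` B) (F c (Z w))%:E)%E.
Proof.
move=> mB mF Fdf; rewrite ge0_integral_pushforward//.
  by apply: measurable_funTS; exact/measurable_EFinP.
by move=> z _; rewrite lee_fin; exact: distribution_function_ge0 (Fdf z).
Qed.

Lemma cond_distribution_functionP Y Z F : cond_distribution_function P Y Z F <->
  [/\ (forall c, measurable_fun [set: seqR R] (F c)),
      (forall c (B : set (seqR R)), measurable B ->
        P ([set w | Y w <= c] `&` Z @^-1` B) =
        (\int[distribution P Z]_(z in B) (F c z)%:E)%E)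
    & (forall z, is_distribution_function (F^~ z))].
Proof.
split=> -[mF FP Fdf]; split => // c B mB;
  by rewrite FP// integral_distribution_function_pushforward.
Qed.

Lemma cond_distribution_function_same_law Y Y' Z Z' F :
  (forall (A : set R) (B : set (seqR R)), measurable A -> measurable B ->
    P (Y @^-1` A `&` Z @^-1` B) = P (Y' @^-1` A `&` Z' @^-1` B)) ->
  cond_distribution_function P Y Z F -> cond_distribution_function P Y' Z' F.
Proof.
move=> YZ /cond_distribution_functionP[mF FP Fdf].
apply/cond_distribution_functionP; split => // c B mB.
have mray : measurable [set y : R | y <= c].
  by rewrite -set_itvNyc; exact: measurable_itv.
have <- := YZ _ _ mray mB; rewrite (FP c B mB).
apply: eq_measure_integral => A mA _.
by have := YZ _ _ measurableT mA; rewrite !preimage_setT !setTI.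
Qed.

Lemma cond_distribution_function_unique Y Z F F' :
  cond_distribution_function P Y Z F -> cond_distribution_function P Y Z F' ->
  {ae distribution P Z, forall z, F^~ z = F'^~ z}.
Proof.
move=> /cond_distribution_functionP[mF FP Fdf].
move=> /cond_distribution_functionP[mF' F'P F'df].
have FF' c : {ae distribution P Z, forall z, F c z = F' c z}.
  suff : ae_eq (distribution P Z) setT (EFin \o F c) (EFin \o F' c).
    by apply: filterS => z /(_ I)[].
  apply: integral_ae_eq => // [||B _ mB]; last by rewrite -FP// -F'P.
  - apply: measurable_bounded_integrable => //.
      by rewrite ltey_eq fin_num_measure.
    exists 1; split => // M M1 z _.
    rewrite /= ger0_norm; last exact: distribution_function_ge0 (Fdf z).
    by apply: le_trans (ltW M1); exact: distribution_function_le1 (Fdf z).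
  - exact/measurable_EFinP.
have : {ae distribution P Z, forall z, forall n,
    if @unpickle rat n is Some q then F (ratr q) z = F' (ratr q) z else True}.
  by apply: ae_foralln => n; case: unpickle => [q|]; [exact: FF'|exact: aeW].
apply: filterS => z FF'z; apply/funext; apply: right_continuous_eq_rat.
- by case: (Fdf z).
- by case: (F'df z).
- by move=> q; have := FF'z (pickle q); rewrite pickleK.
Qed.

Lemma cond_distribution_function_comp Y Z (h : {mfun seqR R >-> seqR R}) F :
  ae_generates_sigma_algebra (distribution P Z) h ->
  cond_distribution_function P Y (h \o Z) F ->
  cond_distribution_function P Y Z (fun c => F c \o h).
Proof.
move=> gen_h [mF FP Fdf].
have mFh c : measurable_fun [set: seqR R] (F c \o h) by exact: measurableT_comp.
have Fhdf z : is_distribution_function (fun c => (F c \o h) z) by exact: Fdf.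
apply/cond_distribution_functionP; split => // c B mB.
have [E mE BE] := gen_h B mB.
have mhE : measurable (h @^-1` E) by exact: measurable_funPTI.
have mray : measurable [set w | Y w <= c].
  rewrite (_ : [set w | _] = Y @^-1` `]-oo, c]); last by rewrite set_itvNyc.
  exact: measurable_funPTI.
transitivity (P ([set w | Y w <= c] `&` Z @^-1` (h @^-1` E))).
  apply: measure_ae_eq_set.
  - by apply: measurableI => //; exact: measurable_funPTI.
  - by apply: measurableI => //; exact: measurable_funPTI.
  - by apply: filterS (ae_pushforward_preimage BE) => w BEw; split=> -[Yw /BEw].
rewrite FP// -(integral_distribution_function_pushforward Z mhE (mFh c) Fhdf).
apply/esym/ge0_integral_ae_eq_set => //; first exact/measurable_EFinP.
by move=> z; rewrite lee_fin; exact: distribution_function_ge0 (Fhdf z).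
Qed.

End conditional_distribution_functions.

Section decoder.
Context {R : realType} {d : measure_display} {Omega : measurableType d}
  {P : probability Omega R}.
Implicit Types X Y nu : int -> {RV P >-> R}.

Lemma measurable_Hseq (H : {mfun seqR R >-> R}) :
  measurable_fun [set: seqR R] (Hseq H).
Proof.
apply: measurable_fun_seqR => k.
exact: (measurableT_comp (measurable_funP H) (measurable_reindex (addn k))).
Qed.

HB.instance Definition _ (H : {mfun seqR R >-> R}) :=
  isMeasurableFun.Build _ _ _ _ (Hseq H) (measurable_Hseq H).

Lemma decoder_set_inj (H : seqR R -> R) :
  decoder_injective H -> set_inj (@in01 R) (Hseq H).
Proof. by move=> injH b b'; rewrite !inE; exact: injH. Qed.

Lemma Hseq_pastR (H : seqR R -> R) (xhat nu : int -> Omega -> R) (s : int) :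
  (forall s w, xhat s w = H (pastR nu s w)) ->
  Hseq H \o pastR nu s = pastR xhat s.
Proof.
move=> xhatE; apply/funext => w; apply/funext => k.
rewrite /pastR xhatE /= /Hseq; congr H; apply/funext => j.
by rewrite /pastR PoszD opprD addrA.
Qed.

Lemma ae_past_in01 nu (s : int) : iid_uniform01 P (fun s => nu s) ->
  {ae distribution P (pastR (fun s => nu s) s), forall b, in01 b}.
Proof.
move=> [nu_law _]; apply: ae_foralln => k.
have mC01 : measurable (~` `[0 : R, 1]%classic) by exact: measurableC.
exists ((fun b : seqR R => b k) @^-1` ~` `[0, 1]%classic); split.
- exact: measurable_coordinate_preimage.
- by have := nu_law (s - k%:Z) _ mC01; rewrite setICl measure0.
- by move=> b /= nb; rewrite in_itv.
Qed.

Lemma same_fdd_present_past X Y (t : int) (A : set R) (B : set (seqR R)) :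
  same_fdd P (fun s => X s) (fun s => Y s) -> measurable A -> measurable B ->
  P (X t @^-1` A `&` pastR (fun s => X s) (t - 1) @^-1` B) =
  P (Y t @^-1` A `&` pastR (fun s => Y s) (t - 1) @^-1` B).
Proof.
move=> XY mA mB.
pose tail (a : seqR R) : seqR R := a \o S.
pose C : set (seqR R) := (fun a : seqR R => a 0%N) @^-1` A `&` tail @^-1` B.
have mC : measurable C.
  apply: measurableI; first exact: measurable_coordinate_preimage.
  by rewrite -[X in measurable X]setTI; exact: measurable_reindex.
have CE (Z : int -> Omega -> R) :
    Z t @^-1` A `&` pastR Z (t - 1) @^-1` B = pastR Z t @^-1` C.
  have tail_past w : tail (pastR Z t w) = pastR Z (t - 1) w.
    apply/funext => k.
    by rewrite /tail /pastR /= -addn1 PoszD opprD addrCA addrC.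
  have past0 w : pastR Z t w 0%N = Z t w by rewrite /pastR subr0.
  by apply/seteqP; split => w; rewrite /C /= tail_past past0.
by rewrite !CE; exact: same_fdd_pastR.
Qed.

End decoder.

Theorem theorem2 (R : realType) (d : measure_display) (Omega : measurableType d)
  (P : probability Omega R)
  (x nu xhat : int -> {RV P >-> R}) (G H : seqR R -> R)
  (t : int) (F Fhat : R -> seqR R -> R) :
  stationary P (fun s => x s) ->
  measurable_fun [set: seqR R] G ->
  measurable_fun [set: seqR R] H ->
  (forall (s : int) (w : Omega), nu s w = G (pastR (fun s => x s) s w)) ->
  (forall (s : int) (w : Omega), xhat s w = H (pastR (fun s => nu s) s w)) ->
  iid_uniform01 P (fun s => nu s) ->
  same_fdd P (fun s => xhat s) (fun s => x s) ->
  decoder_injective H ->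
  cond_distribution_function P (x t) (pastR (fun s => x s) (t - 1)) F ->
  cond_distribution_function P (xhat t) (pastR (fun s => nu s) (t - 1)) Fhat ->
  {ae pushforward P (pastR (fun s => x s) (t - 1)), forall a : seqR R,
     (exists b : seqR R, in01 b /\ Hseq H b = a) /\
     (forall b : seqR R, in01 b -> Hseq H b = a ->
        {ae (@lebesgue_measure R), forall c : R, F c a = Fhat c b})}.
Proof.
move=> _ _ mH _ xhatE iid_nu xhat_x injH F_cond Fhat_cond.
pose Hm : {mfun seqR R >-> R} := mfun_Sub (mem_set mH).
pose past_nu := pastR (fun s => nu s) (t - 1).
have past_xhatE : Hseq Hm \o past_nu = pastR (fun s => xhat s) (t - 1).
  exact: Hseq_pastR.
have nu01 := ae_past_in01 (t - 1) iid_nu.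
have Hseq_gen : ae_generates_sigma_algebra (distribution P past_nu) (Hseq Hm).
  by apply: injective_ae_generates_seqR nu01 _; exact: decoder_set_inj.
have F_xhat : cond_distribution_function P (xhat t) (Hseq Hm \o past_nu) F.
  rewrite past_xhatE; apply: cond_distribution_function_same_law F_cond.
  by move=> A B mA mB; apply/esym/same_fdd_present_past.
have F_nu := cond_distribution_function_comp Hseq_gen F_xhat.
have F_Fhat := cond_distribution_function_unique F_nu Fhat_cond.
have := ae_pushforward_image_seqR (Hseq Hm) (filterI nu01 F_Fhat).
move=> [N [mN N0 goodN]]; exists N; split => //.
  rewrite -N0 -[RHS]/(P ((Hseq Hm \o past_nu) @^-1` N)) past_xhatE.
  by apply/esym/same_fdd_pastR.
move=> a bad_a; apply: goodN => -[b [b01 Fb] Hb]; apply: bad_a.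
split=> [|b' b'01]; first by exists b.
rewrite -Hb => /(injH _ _ b'01 b01) ->.
by apply: aeW => c; exact: (congr1 (@^~ c) Fb).
Qed.
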